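(* Let $\Phi=\{\phi_e\}_{e\in\mathbb N}$ be a finitely irreducible CGDMS with Bowen parameter $h$ and let $F=\{f_e\}_{e\in\mathbb N}$ be a Hölder family of functions that is uniformly bounded below. Let $q_1<-1$ be such that $(0,q_1)\in D$. Fix $0\le t\le h$. Then the family of Gibbs states $\{\tilde\mu_{t,q}\}_{q<q_1}$ is tight: for every $\varepsilon>0$ there is a compact set $K\subseteq E_A^\infty$ such that $\tilde\mu_{t,q}(K)>1-\varepsilon$ for all $q<q_1$.
   Context: CGDMS. Let $(V,E,i,t)$ be a directed multigraph with finite vertex set $V$, countable edge set $E$ (the alphabet; here $E=\mathbb N$) and maps $i,t:E\to V$, and let $A:E\times E\to\{0,1\}$ be a matrix with at least one $1$ in each row such that $A_{ab}=1$ implies $t(a)=i(b)$. Let $\{X_v\}_{v\in V}$ be nonempty compact subsets of $\mathbb R^d$ (regarded as disjoint copies), each the closure of its interior, and $X=\bigsqcup_v X_v$. A conformal graph directed Markov system (CGDMS) is a family of maps $\Phi=\{\phi_e:X_{t(e)}\to X_{i(e)}\}_{e\in E}$ (together with the graph and $A$) such that: (1) $\phi_a(\mathrm{Int}X_{t(a)})\cap\phi_b(\mathrm{Int}X_{t(b)})=\emptyset$ for $a\ne b$; (2) for every $v$ there is an open, connected, bounded $W_v\supseteq X_v$ in $\mathbb R^d$ such that each $\phi_e$ with $t(e)=v$ extends to a contracting conformal diffeomorphism of $W_v$ into $\mathbb R^d$, all with a common contraction ratio $s<1$; (3) there are $L\ge1$, $\kappa>0$ with $\bigl||\phi_e'(y)|-|\phi_e'(x)|\bigr|\le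 L|\phi_e'(x)|\,\|y-x\|^\kappa$ for all $e$ and $x,y\in W_{t(e)}$, where $|\phi_e'(x)|$ is the scaling factor (norm) of the derivative. Symbolic space. $E_A^n$ is the set of words $w=w_1\dots w_n$ with $A_{w_kw_{k+1}}=1$ for all $k$; $E_A^*$ is the set of all finite such words including the empty word; $E_A^\infty$ is the set of infinite such sequences, with the product topology and shift $\sigma$; $[w]$ is the cylinder of $\omega\in E_A^\infty$ beginning with $w$; $\omega|_n=\omega_1\dots\omega_n$. For $w\in E_A^n$: $t(w)=t(w_n)$, $\sigma(w)=w_2\dots w_n$, $\phi_w=\phi_{w_1}\circ\cdots\circ\phi_{w_n}$, and $\phi$ of the empty word is the identity. $\pi:E_A^\infty\to X$ is defined by $\{\pi(\omega)\}=\bigcap_n\phi_{\omega|_n}(X_{t(\omega|_n)})$. $\Phi$ is finitely irreducible if there is a finite set $I\subseteq E_A^*$ such that for all $e,f\in E$ some $\tau\in I$ has $e\tau f\in E_A^*$. Families. A family $F=\{f_e:X_{t(e)}\to\mathbb R\}_{e\in E}$ is Hölder if for some $\beta>0$, $\sup_{n\ge1}\sup_{w\in E_A^n}\sup_{x,y\in X_{t(w)}}|f_{w_1}(\phi_{\sigma(w)}(x))-f_{w_1}(\phi_{\sigma(w)}(y))|e^{\beta n}<\infty$. It is uniformly bounded below if there is $K\in\mathbb R$ with $f_e\ge K$ for all $e$. The amalgamated function is $\tilde f(\omega)=f_{\omega_1}(\pi(\sigma(\omega)))$; that of $\log\Phi'=\{\log|\phi_e'|\}_e$ is $\Xi_\Phi(\omega)=\log|\phi_{\omega_1}'(\pi(\sigma(\omega)))|$.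 Put $f_{t,q}=t\,\Xi_\Phi+q\tilde f$. Pressure. For a family $G=\{g_e\}$ and $w\in E_A^n$, $S_w(G)=\sum_{j=1}^n g_{w_j}\circ\phi_{\sigma^j(w)}$, and $P(t,q)=\lim_{n\to\infty}\frac1n\log\sum_{w\in E_A^n}\|\exp S_w(t\log\Phi'+qF)\|_{X_{t(w)}}\in(-\infty,\infty]$, with sup norms. $P(t):=P(t,0)$; the Bowen parameter is $h=\inf\{t\ge0:P(t)\le0\}$. The Manhattan region is $D=\{(t,q)\in\mathbb R^2:\sum_{e\in\mathbb N}\|\exp(f_e)\|_{X_{t(e)}}^q\,\||\phi_e'|\|_{X_{t(e)}}^t<\infty\}$. Measures. A Gibbs state for $\varphi:E_A^\infty\to\mathbb R$ is a Borel probability $m$ on $E_A^\infty$ for which there are $P\in\mathbb R$, $C\ge1$ with $C^{-1}\le m([w])/\exp(\sum_{j=0}^{|w|-1}\varphi(\sigma^j\rho)-P|w|)\le C$ for all $w\in E_A^*$, $\rho\in[w]$. For $(t,q)\in D$, $\tilde\mu_{t,q}$ is the unique $\sigma$-invariant Gibbs state of $f_{t,q}$. Under the hypotheses $(t,q)\in D$ for all $0\le t\le h$, $q\le q_1$. *)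

(* Defs.v *)
From HB Require Import structures.
From mathcomp Require Import all_boot all_order all_algebra.
From mathcomp Require Import all_classical all_reals all_analysis.
Set Implicit Arguments.
Unset Strict Implicit.
Unset Printing Implicit Defensive.
Import Order.TTheory GRing.Theory Num.Theory.
Import numFieldNormedType.Exports.
Local Open Scope classical_set_scope.
Local Open Scope ring_scope.

Section euclidean.
Variables (R : realType) (d : nat).
Implicit Types (U W : set 'rV[R]_d) (f g : 'rV[R]_d -> 'rV[R]_d).

(* The library's norm on 'rV[R]_d is the sup norm; contraction ratios and
   conformality refer to the Euclidean norm. The two induce the same topology,
   the same differentiable maps and the same bounded sets. *)
Definition enorm (u : 'rV[R]_d) : R := Num.sqrt (\sum_(j < d) u ord0 j ^+ 2).

Definition C1_on U f :=
  (forall x, U x -> differentiable f x) /\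
  (forall u, {within U, continuous (fun x => 'd f x u)}).

Definition diffeo_into W f :=
  [/\ C1_on W f, open (f @` W) &
      exists g, C1_on (f @` W) g /\ forall x, W x -> g (f x) = x].

(* The derivative at each point is a similarity (orientation may be
   reversed). *)
Definition conformal_on W f :=
  forall x, W x -> exists c : R, 0 < c /\
    forall u, enorm ('d f x u) = c * enorm u.

Definition scaling f (x : 'rV[R]_d) : R :=
  sup [set enorm ('d f x u) | u in [set u | enorm u = 1]].

End euclidean.

(* The alphabet is nat. The map phi e stands for the extension of
   X_{t(e)} -> X_{i(e)} to W_{t(e)}; its values off W (tgt e) are never used.
   Since X_v is the closure of its interior and the extension is C^1, the
   derivative on X_{t(e)} does not depend on the extension. *)
Record cgdms (R : realType) (d : nat) (V : finType) := Cgdms {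
  src : nat -> V ;
  tgt : nat -> V ;
  adm : rel nat ;
  adm_row : forall a, exists b, adm a b ;
  adm_match : forall a b, adm a b -> tgt a = src b ;
  X : V -> set 'rV[R]_d ;
  X_neq0 : forall v, X v !=set0 ;
  X_compact : forall v, compact (X v) ;
  X_regular : forall v, X v = closure (interior (X v)) ;
  phi : nat -> 'rV[R]_d -> 'rV[R]_d ;
  phi_maps : forall e x, X (tgt e) x -> X (src e) (phi e x) ;
  (* The X_v are disjoint copies, so images lying in different copies are
     disjoint by convention; only edges with the same initial vertex matter. *)
  phi_disjoint : forall a b, a != b -> src a = src b ->
    (phi a @` interior (X (tgt a))) `&` (phi b @` interior (X (tgt b))) = set0 ;
  W : V -> set 'rV[R]_d ;
  W_open : forall v, open (W v) ;
  W_connected : forall v, connected (W v) ;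
  W_bounded : forall v, bounded_set (W v) ;
  X_sub_W : forall v, X v `<=` W v ;
  phi_diffeo : forall e, diffeo_into (W (tgt e)) (phi e) ;
  phi_conformal : forall e, conformal_on (W (tgt e)) (phi e) ;
  phi_contract : exists s : R, s < 1 /\
    forall e x y, W (tgt e) x -> W (tgt e) y ->
      enorm (phi e x - phi e y) <= s * enorm (x - y) ;
  phi_distortion : exists L kappa : R, [/\ 1 <= L, 0 < kappa &
    forall e x y, W (tgt e) x -> W (tgt e) y ->
      `| scaling (phi e) y - scaling (phi e) x |
        <= L * scaling (phi e) x * enorm (y - x) `^ kappa]
}.

Section symbolic.
Variables (R : realType) (d : nat) (V : finType) (Phi : cgdms R d V).

(* E_A^*, including the empty word. *)
Definition word (w : seq nat) : bool := sorted (adm Phi) w.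

Definition finitely_irreducible :=
  exists I : seq (seq nat), all word I /\
    forall e f, exists2 tau, tau \in I & word (e :: tau ++ [:: f]).

(* Sequences are indexed from 0: w k is the (k+1)-st letter. *)
Definition admissible : set (prod_topology (fun _ : nat => nat)) :=
  [set w | forall k, adm Phi (w k) (w k.+1)].

Definition EAinf : Type := set_type admissible.

HB.instance Definition _ := Topological.copy EAinf (set_type admissible).

Definition letter (w : EAinf) (k : nat) : nat := set_val w k.

Lemma EAinf_neq0 :
  admissible (fun k => iter k (fun a => xchoose (adm_row Phi a)) 0%N).
Proof. by move=> k; exact: (xchooseP (adm_row Phi _)). Qed.

HB.instance Definition _ := isPointed.Build EAinf
  (exist (fun w => w \in admissible) _ (mem_set EAinf_neq0) : set_type admissible).

Lemma sigma_subproof (w : EAinf) : admissible (fun k => letter w k.+1).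
Proof. by move=> k; exact: (set_mem (valP w) k.+1). Qed.

Definition sigma (w : EAinf) : EAinf :=
  exist (fun w => w \in admissible) _ (mem_set (sigma_subproof w)).

Definition first_letters (w : EAinf) (n : nat) : seq nat := mkseq (letter w) n.

Definition cylinder (w : seq nat) : set EAinf :=
  [set rho | first_letters rho (size w) = w].

Definition phiw (w : seq nat) : 'rV[R]_d -> 'rV[R]_d :=
  foldr (fun e g => phi Phi e \o g) id w.

(* Meaningful for nonempty words only. *)
Definition tgtw (w : seq nat) : V := tgt Phi (last 0%N w).

Definition coding (w : EAinf) : 'rV[R]_d :=
  xget 0 (\bigcap_(n in [set n | (0 < n)%N])
            (phiw (first_letters w n) @` X Phi (tgtw (first_letters w n)))).

End symbolic.

Arguments cylinder {R d V} Phi w.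
Arguments sigma {R d V} Phi w.

Notation borelEAinf Phi := (g_sigma_algebraType (@open (EAinf Phi))).

Section thermodynamic.
Variables (R : realType) (d : nat) (V : finType) (Phi : cgdms R d V).

(* A family {f_e : X_{t(e)} -> R}; only the values on X (tgt e) are used. *)
Definition fun_family := nat -> 'rV[R]_d -> R.
Implicit Types (F G : fun_family) (t q : R) (w : seq nat).

Definition holder_family F :=
  exists beta : R, 0 < beta /\
    (ereal_sup [set z | exists e w x y,
       [/\ word Phi (e :: w), X Phi (tgtw Phi (e :: w)) x, X Phi (tgtw Phi (e :: w)) y &
           z = (`| F e (phiw Phi w x) - F e (phiw Phi w y) |
                  * expR (beta * (size (e :: w))%:R))%:E]] < +oo)%E.

Definition bounded_below F :=
  exists K : R, forall e x, X Phi (tgt Phi e) x -> K <= F e x.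

Definition log_deriv : fun_family := fun e x => ln (scaling (phi Phi e) x).

Definition amalgamated F (rho : EAinf Phi) : R :=
  F (letter rho 0) (coding (sigma Phi rho)).

Definition potential F t q (rho : EAinf Phi) : R :=
  t * amalgamated log_deriv rho + q * amalgamated F rho.

Definition birkhoff w G (x : 'rV[R]_d) : R :=
  \sum_(j < size w) G (nth 0%N w j) (phiw Phi (drop j.+1 w) x).

Definition supnorm (U : set 'rV[R]_d) (g : 'rV[R]_d -> R) : \bar R :=
  ereal_sup [set (`| g x |)%:E | x in U].

Definition partition_sum G (n : nat) : \bar R :=
  (\esum_(w in [set w | size w = n /\ word Phi w])
     supnorm (X Phi (tgtw Phi w)) (fun x => expR (birkhoff w G x)))%E.

Definition pressure F t q : \bar R :=
  limn (fun n : nat => (n%:R^-1)%:E *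
    lne (partition_sum (fun e x => (t * log_deriv e x + q * F e x)%R) n))%E.

(* At q = 0 the family F plays no role, and the zero family is used. *)
Definition bowen : \bar R :=
  ereal_inf [set t%:E | t in
    [set t : R | 0 <= t /\ (pressure (fun _ _ => 0%R) t 0%R <= 0)%E]].

Definition manhattan F : set (R * R) :=
  [set p | (\sum_(0 <= e <oo)
     (poweR (supnorm (X Phi (tgt Phi e)) (fun x => expR (F e x))) p.2 *
      poweR (supnorm (X Phi (tgt Phi e)) (scaling (phi Phi e))) p.1) < +oo)%E].

Definition gibbs (m : probability (borelEAinf Phi) R) (g : EAinf Phi -> R) :=
  exists P C : R, 1 <= C /\
    forall w (rho : EAinf Phi), word Phi w -> cylinder Phi w rho ->
      C^-1 <= fine (m (cylinder Phi w)) /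
        expR (\sum_(j < size w) g (iter j (sigma Phi) rho)
              - P * (size w)%:R) <= C.

Definition shift_invariant (m : probability (borelEAinf Phi) R) :=
  forall B : set (borelEAinf Phi), measurable B ->
    m (sigma Phi @^-1` B) = m B.

End thermodynamic.

Arguments potential {R d V} Phi F t q rho.

(* Main.v *)
Require Import Defs.
From mathcomp Require Import all_boot all_order all_algebra.
From mathcomp Require Import all_classical all_reals all_analysis.
From mathcomp Require Import lra.
Import Order.TTheory GRing.Theory Num.Theory.
Import numFieldNormedType.Exports.
Local Open Scope classical_set_scope.
Local Open Scope ring_scope.

(** Tightness reduces to one letter: if the mass of the event that the first
    letter is at least [n] tends to 0 uniformly over the family, then, by shift
    invariance, a product of finite boxes of letters carries mass close to 1
    for all the measures at once, and such a product is compact in the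
    sequence space ([tight_of_letter_tails]).

    The difficulty is that the constant [C] of the Gibbs inequalities depends
    on [q] in an unknown way, so these inequalities cannot be applied to
    cylinders of length one. They are applied to long words instead. For an
    invariant Gibbs state, a set [S] of letters and [a >= 0], the exponential
    moment of [a] times the number of letters in [S] among the first [N] is at
    most [C * B ^ N], where [B] is the sum over the letters [e] of the weights
    [exp (sup g - P)], the supremum of the potential [g] being over the
    sequences that begin with [e], multiplied by [exp a] when [e] is in [S].
    By Jensen's inequality and invariance, [N * a * m(S) <= ln C + N * ln B] up
    to a bounded error; as [N] grows, [C] disappears and
    [a * m(S) <= ln B] remains ([mean_letter_weight]).

    It remains to choose [a] and [B] for each [q] so that [ln B / a] is small
    uniformly. The potential is at most [q * b e] on the sequences that begin
    with [e], where [b e] bounds [f_e] from below: the maps contract, so the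
    geometric part is nonpositive ([potential_le]). Averaging the
    Gibbs inequalities along a periodic orbit shows that the pressure constant
    is at least [q * c] with [c] independent of [q] ([periodic_pressure_bound]).
    So the weights are at most [exp (q * (b e - c))], their sum is at most
    [exp (c3 * |q|)] for a constant [c3], and with [a = Lam * |q|] the letters
    [e >= n] contribute at most 1 as soon as [n] makes the tail of the series
    of the [exp (q1 * b e)] small enough, a condition that does not involve
    [q]. Then [ln B / a <= (c3 + 1) / Lam], and [Lam] is at our disposal
    ([uniform_weights]). *)

(** * Limit points of the system and size of the derivatives *)

Section geometry.
Context {R : realType} {d : nat} {V : finType} {Phi : cgdms R d V}.
Implicit Types (rho : EAinf Phi) (w : seq nat).

Lemma adm_letter rho k : adm Phi (letter rho k) (letter rho k.+1).
Proof. exact: (set_mem (valP rho) k). Qed.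

Lemma word_first_letters rho n : word Phi (first_letters rho n).
Proof.
apply/(sortedP 0%N) => i; rewrite size_mkseq => lt_in.
by rewrite !nth_mkseq ?(ltnW lt_in) //; exact: adm_letter.
Qed.

Lemma phiw_maps e w x :
  word Phi (e :: w) -> X Phi (tgtw Phi (e :: w)) x ->
  X Phi (src Phi e) (phiw Phi (e :: w) x).
Proof.
elim: w e => [|e' w IH] e /=; first by move=> _; exact: phi_maps.
move=> /andP[ee' we'] xX; apply: phi_maps; rewrite (adm_match ee').
exact: IH.
Qed.

Lemma phiw_rcons w e x : phiw Phi (rcons w e) x = phiw Phi w (phi Phi e x).
Proof. by elim: w => //= a w ->. Qed.

Lemma phiw_compact e w : word Phi (e :: w) ->
  compact (phiw Phi (e :: w) @` X Phi (tgtw Phi (e :: w))).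
Proof.
have step a (A : set 'rV[R]_d) : A `<=` X Phi (tgt Phi a) -> compact A ->
    compact (phi Phi a @` A).
  move=> AX; apply: continuous_compact; apply: continuous_in_subspaceT => x.
  move=> /set_mem /AX /X_sub_W xW; apply: differentiable_continuous.
  by have [[+ _] _ _] := phi_diffeo Phi a; apply.
elim: w e => [|e' w IH] e; first by move=> _; exact/step/X_compact.
move=> ww; have /= /andP[ee' we'] := ww.
rewrite [X in compact X](_ : _ = phi Phi e @`
   (phiw Phi (e' :: w) @` X Phi (tgtw Phi (e' :: w)))); last first.
  by rewrite image_comp.
apply/step; last exact: IH.
by move=> _ [x xX <-]; rewrite (adm_match ee'); exact: phiw_maps.
Qed.

(** The images of the compact sets along the prefixes of [rho] are nested, so
    they have a common point; hence the coding point is a point of the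
    intersection and not the default value of [xget]. *)
Lemma coding_in_X rho : X Phi (src Phi (letter rho 0)) (coding rho).
Proof.
pose D n := phiw Phi (first_letters rho n.+1) @`
  X Phi (tgtw Phi (first_letters rho n.+1)).
have flS n : first_letters rho n.+1 =
    letter rho 0 :: mkseq (fun k => letter rho k.+1) n.
  by rewrite /first_letters /mkseq -[n.+1]add1n iotaD /= (iotaDl 1 0) -map_comp.
have D_compact n : compact (D n).
  rewrite /D flS; apply: phiw_compact; rewrite -flS.
  exact: word_first_letters.
have D_neq0 n : D n !=set0.
  have [x xX] := X_neq0 Phi (tgtw Phi (first_letters rho n.+1)).
  by exists (phiw Phi (first_letters rho n.+1) x); exists x.
have tgtwS n : tgtw Phi (first_letters rho n.+1) = tgt Phi (letter rho n).
  by rewrite /tgtw /first_letters mkseqS last_rcons.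
have D_sub n : D n.+1 `<=` D n.
  move=> _ [x + <-]; rewrite tgtwS => xX.
  exists (phi Phi (letter rho n.+1) x).
    by rewrite tgtwS (adm_match (adm_letter rho n)); exact: phi_maps.
  by rewrite [in RHS]/first_letters mkseqS phiw_rcons.
have D_mono m n : (m <= n)%N -> D n `<=` D m.
  move=> /subnKC <-; elim: (n - m)%N => [|k IH]; rewrite ?addn0 // addnS.
  exact: subset_trans (D_sub _) IH.
(* A cluster point of any choice of points in the [D n] lies in all of them. *)
have [y yD] : \bigcap_(n in [set n | (0 < n)%N]) (phiw Phi (first_letters rho n)
    @` X Phi (tgtw Phi (first_letters rho n))) !=set0.
  pose u n := xget 0 (D n).
  have uD n : D n (u n) by apply: xgetPex; exact: D_neq0.
  have [p [_ p_cl]] : D 0 `&` cluster (u @ \oo) !=set0.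
    by apply: D_compact; exists 0%N => // n _; exact: D_mono (uD n).
  exists p => -[//|n] _; have D_closed : closed (D n).
    by apply: compact_closed (D_compact n); exact: norm_hausdorff.
  apply: D_closed => B Bp; apply: p_cl => //.
  by exists n => // m; move=> /= /D_mono; apply; exact: uD.
have := xgetPex 0 (ex_intro _ y yD); rewrite -/(coding rho) => /(_ 1%N isT).
move=> [x xX <-]; exact: (@phiw_maps (letter rho 0) [::]).
Qed.

Lemma enorm_continuous : continuous (@enorm R d).
Proof.
move=> u; apply: continuous_comp; last exact: sqrt_continuous.
apply: (@continuous_big _ _ _ _ _ add_continuous) => j _ v.
exact: (continuous_comp (@coord_continuous _ _ _ _ _ _) (@exprn_continuous _ _ _)).
Qed.

Lemma enormZ (a : R) (u : 'rV[R]_d) : enorm (a *: u) = `|a| * enorm u.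
Proof.
rewrite /enorm -sqrtr_sqr -sqrtrM ?sqr_ge0 // mulr_sumr.
by under eq_bigr do rewrite mxE exprMn.
Qed.

(** The derivative in the direction of a unit vector is a limit of difference
    quotients, each of Euclidean norm at most 1 because the map contracts. *)
Lemma scaling_le1 e x : W Phi (tgt Phi e) x -> scaling (phi Phi e) x <= 1.
Proof.
move=> xW; rewrite /scaling.
set S := [set _ | _ in _].
(* In dimension 0 there is no unit vector and the supremum is that of the
   empty set. *)
have [->|/set0P S0] := eqVneq S set0; first by rewrite sup0.
apply: ge_sup => // _ [u /= u1 <-].
have [[dphi _] _ _] := phi_diffeo Phi e.
rewrite -deriveE; last exact: dphi.
have [s [s1 contr]] := phi_contract Phi.
pose quot h : 'rV[R]_d := h^-1 *: ((phi Phi e \o shift x) (h *: u) - phi Phi e x).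
have quot_cvg : enorm (quot h) @[h --> 0^'] --> enorm ('D_u (phi Phi e) x).
  apply: continuous_cvg; first exact: enorm_continuous.
  by apply: diff_derivable; exact: dphi.
rewrite -(cvg_lim (@norm_hausdorff _ _) quot_cvg).
apply: limr_le; first by apply/cvg_ex; exists (enorm ('D_u (phi Phi e) x)).
have W_near : \forall h \near (0 : R)^', W Phi (tgt Phi e) (h *: u + x).
  have line_cvg : (h *: u + x) @[h --> (0 : R)^'] --> x.
    rewrite -{2}[x]add0r -(scale0r u); apply: cvg_within_filter.
    by apply: cvgD; [apply: cvgZr_tmp; exact: cvg_id|exact: cvg_cst].
  by apply: line_cvg; apply: open_nbhs_nbhs; split=> //; exact: W_open.
near=> h; rewrite /=.
have h0 : h != 0 by near: h; exact: nbhs_dnbhs_neq.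
rewrite /quot /= enormZ normfV ler_pdivrMl ?normr_gt0 // mulr1.
have hW : W Phi (tgt Phi e) (h *: u + x) by near: h.
apply: le_trans (contr _ _ _ hW xW) _.
rewrite addrK enormZ u1 mulr1 -[leRHS]mul1r ler_wpM2r //.
exact: ltW.
Unshelve. all: by end_near. Qed.

End geometry.

(** * Mean number of visits of a stationary sequence of letters *)

Section letter_weight.
Context {disp : measure_display} {T : measurableType disp} {R : realType}.
Implicit Types (m : probability T R).

Lemma probability_fine m (A : set T) : measurable A -> (fine (m A))%:E = m A.
Proof. by move=> mA; rewrite fineK // fin_num_measure. Qed.

Lemma fine_probability_bigcup m (I : finType) (P : pred I) (F : I -> set T) :
  (forall i, measurable (F i)) -> trivIset setT F ->
  \sum_(i | P i) fine (m (F i)) = fine (m (\bigcup_(i in [set` P]) F i)).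
Proof.
move=> mF tF; rewrite measure_fin_bigcup //; last first.
- exact: sub_trivIset tF.
- rewrite -(@bigfs _ _ _ _ (index_enum I)) ?index_enum_uniq //; last first.
    by move=> i _; rewrite mem_index_enum.
  by rewrite sum_fine // => i _; exact: fin_num_measure.
Qed.

Lemma fine_probability_setU_bigsetU m (A B : set T) (F : nat -> set T) n :
  measurable A -> measurable B -> (forall i, measurable (F i)) ->
  A `<=` B `|` \big[setU/set0]_(i < n) F i ->
  fine (m A) <= fine (m B) + \sum_(i < n) fine (m (F i)).
Proof.
move=> mA mB mF AB.
rewrite -lee_fin EFinD !probability_fine // -sumEFin.
under eq_bigr do rewrite probability_fine //.
have mU : measurable (\big[setU/set0]_(i < n) F i) by exact: bigsetU_measurable.
apply: (@le_trans _ _ (m (B `|` \big[setU/set0]_(i < n) F i))).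
  by apply: le_measure; rewrite ?inE //; exact: measurableU.
apply: le_trans (measureU2 _ mB mU) _.
by rewrite leeD2l //; exact: Boole_inequality.
Qed.

Lemma tail_probability_small m (xi : T -> nat) (e : R) :
  (forall S : pred nat, measurable [set r | S (xi r)]) -> 0 < e ->
  exists L, fine (m [set r | (L <= xi r)%N]) <= e.
Proof.
move=> mxi e0; pose F L := [set r | (L <= xi r)%N].
have mF L : measurable (F L) by exact: (mxi (fun k => (L <= k)%N)).
have F0 : \bigcap_L F L = set0.
  by rewrite -subset0 => r /(_ (xi r).+1 I); rewrite /F /= ltnn.
have : (m \o F) L @[L --> \oo] --> m (\bigcap_L F L).
  apply: nonincreasing_cvg_mu => //.
  - by rewrite -ge0_fin_numE // fin_num_measure.
  - by rewrite F0; exact: measurable0.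
  - by move=> i j ij; apply/subsetPset => r; exact: leq_trans.
rewrite F0 measure0 => /fine_cvgP[_ /cvgrPdist_le /(_ _ e0)[L _ /(_ L (leqnn L))]].
by rewrite sub0r normrN ger0_norm ?fine_ge0 //; exists L.
Qed.

(** Lets a constant that does not grow with the word length drop out. *)
Lemma nat_mul_bounded (z c : R) : (forall n, n%:R * z <= c) -> z <= 0.
Proof.
move=> nz; rewrite leNgt; apply/negP => z0.
have c0 : 0 <= c by have := nz 0%N; rewrite mul0r.
have := archi_boundP (divr_ge0 c0 (ltW z0)).
by rewrite ltr_pdivrMr // ltNge nz.
Qed.

Lemma measurable_word (xi : nat -> T -> nat) :
  (forall k (Q : pred nat), measurable [set r | Q (xi k r)]) ->
  forall N (f : 'I_N -> nat), measurable [set r | forall j : 'I_N, xi j r = f j].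
Proof.
move=> mxi N f.
rewrite (_ : [set r | _] = \bigcap_(j in [set: 'I_N]) [set r | xi j r == f j]).
  by apply: fin_bigcap_measurable => // j _; exact: (mxi j (pred1 (f j))).
by apply/seteqP; split=> [r rf j _|r rf j]; apply/eqP; [rewrite rf|exact: rf].
Qed.

(** The Gibbs constant [C] disappears because the words are arbitrarily long.
    With [u = ln C + N * ln B], the hypotheses bound the mean of [exp (a * c - u)] by
    1, where [c] counts the letters in [S] among the first [N]; since
    [exp z >= z], the mean of [a * c] is at most [1 + u], and by stationarity
    it is [N] times [a * p]. Dividing by [N] leaves [a * p <= ln B]. To work
    with finite sums, the alphabet is cut at a large [L]: the words of
    length [N] with a letter beyond [L] have arbitrarily small total mass. *)
Lemma mean_letter_weight m (xi : nat -> T -> nat) (x : nat -> R)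
    (S : pred nat) (a C B : R) :
  (forall k (Q : pred nat), measurable [set r | Q (xi k r)]) ->
  (forall k (Q : pred nat), m [set r | Q (xi k r)] = m [set r | Q (xi 0%N r)]) ->
  (forall N (f : 'I_N -> nat),
    fine (m [set r | forall j : 'I_N, xi j r = f j]) <= C * \prod_j x (f j)) ->
  (forall e, 0 <= x e) -> 0 <= a -> 1 <= C -> 1 <= B ->
  (forall L, \sum_(e < L) x e * expR (a * (S e)%:R) <= B) ->
  a * fine (m [set r | S (xi 0%N r)]) <= ln B.
Proof.
move=> mxi stat cyl x0 a0 C1 B1 sumB.
have C0 : 0 < C by exact: lt_le_trans ltr01 C1.
have B0 : 0 < B by exact: lt_le_trans ltr01 B1.
set p := fine _.
suff main N : N%:R * (a * p - ln B) <= 1 + ln C.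
  by rewrite -subr_le0; exact: nat_mul_bounded main.
rewrite mulrBr lerBlDr; set u := ln C + N%:R * ln B; rewrite -addrA -/u.
have u0 : 0 <= u by rewrite addr_ge0 ?mulr_ge0 ?ln_ge0.
apply/ler_addgt0Pr => e e0.
(* This level makes the error [a * N ^ 2 * m(L <= letter)], produced by the
   cut in the estimate [sum_p], at most [e]. *)
have [L pL] : exists L, fine (m [set r | (L <= xi 0%N r)%N]) <=
    e / (a * N%:R ^+ 2 + 1).
  apply: tail_probability_small; first exact: mxi.
  by rewrite divr_gt0 // ltr_wpDl // mulr_ge0.
pose cy (f : {ffun 'I_N -> 'I_L}) := [set r | forall j : 'I_N, xi j r = f j].
have mcy f : measurable (cy f) by exact: measurable_word.
have tcy : trivIset setT cy.
  move=> f g _ _ [r [rf rg]]; apply/ffunP => j; apply/val_inj.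
  by rewrite /= -rf -rg.
pose w f := fine (m (cy f)).
have w0 f : 0 <= w f by exact: fine_ge0.
have w1 : \sum_f w f <= 1.
  rewrite fine_probability_bigcup // -lee_fin probability_fine.
    by apply: probability_le1; apply: fin_bigcup_measurable.
  exact: fin_bigcup_measurable.
pose c (f : {ffun 'I_N -> 'I_L}) : R := \sum_j (S (f j))%:R.
have wc_le : \sum_f w f * (a * c f) <= 1 + u.
  have : \sum_f w f * (a * c f - u) <= 1.
    have bound f : w f * (a * c f - u) <=
        (C * expR (- u)) * \prod_j (x (f j) * expR (a * (S (f j))%:R)).
      apply: (@le_trans _ _ (w f * expR (a * c f - u))).
        by rewrite ler_wpM2l // (le_trans _ (expR_ge1Dx _)) // lerDr.
      rewrite big_split /= -expR_sum -mulr_sumr -/(c f) expRD.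
      rewrite [leRHS](_ : _ = (C * \prod_j x (f j)) * (expR (a * c f) * expR (- u))).
        by rewrite ler_wpM2r ?mulr_ge0 ?expR_ge0 //; exact: cyl.
      by rewrite -!mulrA; congr (C * _); rewrite [LHS]mulrC -!mulrA.
    apply: le_trans (ler_sum _ (fun f _ => bound f)) _.
    rewrite -mulr_sumr.
    rewrite -(bigA_distr_bigA (fun (j : 'I_N) (k : 'I_L) =>
       x k * expR (a * (S k)%:R))) /=.
    have BN0 : B ^+ N != 0 by rewrite expf_neq0 // gt_eqF.
    have normalized : C * expR (- u) * B ^+ N = 1.
      rewrite /u opprD expRD !expRN expRM_natl !lnK ?posrE // mulrA divff ?gt_eqF //.
      by rewrite mul1r mulVf.
    rewrite prodr_const card_ord -[leRHS]normalized.
    rewrite ler_wpM2l ?mulr_ge0 ?expR_ge0 ?(ltW C0) // lerXn2r ?nnegrE ?(ltW B0) //.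
    - by apply: sumr_ge0 => k _; rewrite mulr_ge0 ?expR_ge0.
    - exact: sumB.
  under eq_bigr do rewrite mulrBr.
  rewrite sumrB lerBlDr => /le_trans; apply.
  by rewrite lerD2l -mulr_suml -[leRHS]mul1r ler_wpM2r.
have wcE : \sum_f w f * (a * c f) =
    a * \sum_(j < N) \sum_(f : {ffun 'I_N -> 'I_L} | S (f j)) w f.
  rewrite (exchange_big_dep xpredT) //= mulr_sumr; apply: eq_bigr => f _.
  rewrite mulrCA; congr (a * _); rewrite /c mulr_sumr [RHS]big_mkcond /=.
  by apply: eq_bigr => j _; case: (S (f j)); rewrite ?mulr1 ?mulr0.
(* A sequence whose first [N] letters do not give a word over the cut
   alphabet has one of these letters beyond [L]. *)
have p_le (j : 'I_N) : p <= \sum_(f : {ffun 'I_N -> 'I_L} | S (f j)) w f +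
    N%:R * fine (m [set r | (L <= xi 0%N r)%N]).
  rewrite fine_probability_bigcup //.
  rewrite /p -(stat j).
  rewrite -[X in X%:R * _]card_ord -sum1_card natr_sum mulr_suml.
  under [X in _ <= _ + X]eq_bigr => i _ do
    rewrite mul1r -(stat i (fun k => (L <= k)%N)).
  apply: (@fine_probability_setU_bigsetU m _ _
    (fun i => [set r | (L <= xi i r)%N])) => //.
  - exact: fin_bigcup_measurable.
  move=> r /= Sr; have [lt_L|] := pselect (forall i : 'I_N, (xi i r < L)%N).
    left; exists [ffun i => Ordinal (lt_L i)]; last by move=> i; rewrite ffunE.
    by rewrite /mkset unfold_in /= ffunE.
  move=> /existsNP[i /negP]; rewrite -leqNgt => Li; right.
  by rewrite -(bigcup_mkord N (fun i => [set r | (L <= xi i r)%N])); exists i => //=.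
have sum_p : N%:R * p <=
    \sum_(j < N) \sum_(f : {ffun 'I_N -> 'I_L} | S (f j)) w f +
    N%:R ^+ 2 * fine (m [set r | (L <= xi 0%N r)%N]).
  have := ler_sum (index_enum 'I_N) (P := xpredT) (fun j _ => p_le j).
  rewrite big_split /= !sumr_const card_ord -(mulr_natl p) => /le_trans; apply.
  by rewrite expr2 -[leRHS]addr0 -mulrA (mulr_natl (_ * _)) addr0.
rewrite mulrCA; apply: le_trans (ler_wpM2l a0 sum_p) _.
rewrite mulrDr -wcE lerD // mulrA.
have den0 : 0 < a * N%:R ^+ 2 + 1 by rewrite ltr_wpDl // mulr_ge0.
apply: le_trans (ler_wpM2l _ pL) _; first by rewrite mulr_ge0.
by rewrite mulrCA -[leRHS]mulr1 ler_wpM2l ?(ltW e0) // ler_pdivrMr // mul1r lerDl.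
Qed.

End letter_weight.

(** * Gibbs inequalities on the symbolic space *)

Section symbolic.
Context {R : realType} {d : nat} {V : finType} {Phi : cgdms R d V}.
Implicit Types (rho : EAinf Phi) (m : probability (borelEAinf Phi) R).

Lemma letter_ext rho rho' : letter rho =1 letter rho' -> rho = rho'.
Proof. by move=> /funext h; apply/val_inj. Qed.

Lemma letter_iter_sigma j k rho :
  letter (iter j (sigma Phi) rho) k = letter rho (j + k).
Proof.
elim: j k => //= j IH k.
by rewrite -[LHS]/(letter (iter j (sigma Phi) rho) k.+1) IH addSnnS.
Qed.

Lemma letter_continuous k : continuous (fun rho => letter rho k).
Proof.
move=> rho.
apply: (@continuous_comp _ _ _ (@set_val _ (admissible Phi))
  (@proj nat (fun=> nat) k)); last exact: proj_continuous.
exact: initial_continuous.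
Qed.

Lemma measurable_letter k (Q : pred nat) :
  measurable ([set rho | Q (letter rho k)] : set (borelEAinf Phi)).
Proof.
apply: sub_sigma_algebra.
rewrite (_ : [set _ | _] = (fun rho => letter rho k) @^-1` [set i | Q i]) //.
apply: open_comp; last exact: discrete_open.
by move=> rho _; exact: letter_continuous.
Qed.

Lemma shift_invariant_letter m k (Q : pred nat) : shift_invariant m ->
  m [set rho | Q (letter rho k)] = m [set rho | Q (letter rho 0)].
Proof.
move=> inv; elim: k => // k IH.
by rewrite -IH -(inv _ (measurable_letter k Q)).
Qed.

Lemma cylinderE N (f : 'I_N -> nat) :
  [set rho | forall j : 'I_N, letter rho j = f j] =
  cylinder Phi [seq f j | j <- enum 'I_N].
Proof.
apply/seteqP; split=> rho /=; rewrite /cylinder /= /first_letters /mkseq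
  size_map size_enum_ord -val_enum_ord -map_comp.
  by move=> rf; apply: eq_map => j; rewrite /= rf.
by move=> /eq_in_map + j => /(_ j); rewrite mem_enum; exact.
Qed.

(** The body of [gibbs] with its two constants exposed: the pressure constant
    [P] has to be bounded below uniformly over the measures with this
    property. *)
Definition gibbs_bounds m (g : EAinf Phi -> R) (P C : R) :=
  forall w rho, word Phi w -> cylinder Phi w rho ->
    C^-1 <= fine (m (cylinder Phi w)) /
      expR (\sum_(j < size w) g (iter j (sigma Phi) rho) - P * (size w)%:R)
      <= C.

Lemma gibbs_cylinder_le m g (G : nat -> R) P C :
  gibbs_bounds m g P C -> 0 <= C ->
  (forall rho, g rho <= G (letter rho 0)) ->
  forall N (f : 'I_N -> nat),
    fine (m [set rho | forall j : 'I_N, letter rho j = f j]) <=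
    C * \prod_j expR (G (f j) - P).
Proof.
move=> gibbs C0 gG N f; rewrite cylinderE; set w := map _ _.
have size_w : size w = N by rewrite size_map size_enum_ord.
have [[rho wrho]|/set0P/negP/negPn/eqP ->] :=
  pselect (cylinder Phi w !=set0); last first.
  by rewrite measure0 mulr_ge0 // prodr_ge0 // => j _; exact: expR_ge0.
have letterE (j : 'I_N) : letter rho j = f j.
  by move: wrho; rewrite -cylinderE; exact.
have ww : word Phi w by rewrite -wrho; exact: word_first_letters.
have /andP[_] := gibbs w rho ww wrho; rewrite ler_pdivrMr ?expR_gt0 //.
move=> /le_trans; apply; rewrite ler_wpM2l // -expR_sum ler_expR size_w.
rewrite big_split /= sumr_const card_ord mulNrn mulr_natr lerD2r.
apply: ler_sum => j _; apply: le_trans (gG _) _.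
by rewrite letter_iter_sigma addn0 letterE.
Qed.

(** A cylinder has mass at most 1, so along a periodic orbit the Birkhoff sum
    over [n] periods exceeds [n * p * P] by at most [ln C], for every [n]. *)
Lemma gibbs_periodic_le m g P C rho p :
  gibbs_bounds m g P C -> 0 < C ->
  iter p (sigma Phi) rho = rho ->
  \sum_(j < p) g (iter j (sigma Phi) rho) <= P * p%:R.
Proof.
move=> gibbs C0 per; rewrite -subr_le0.
apply: (@nat_mul_bounded _ _ (ln C)) => n.
have sumE : \sum_(j < n * p) g (iter j (sigma Phi) rho) =
    n%:R * \sum_(j < p) g (iter j (sigma Phi) rho).
  rewrite -(big_mkord xpredT (fun j => g (iter j (sigma Phi) rho))).
  elim: n => [|n IH]; first by rewrite big_geq // mul0r.
  rewrite mulSnr (@big_cat_nat _ _ _ (n * p)) ?leq_addr //= IH -natr1 mulrDl mul1r.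
  congr (_ + _); rewrite -[X in \sum_(X <= i < _) _]add0n.
  rewrite big_addn big_mkord addKn; apply: eq_bigr => j _.
  rewrite iterD; congr (g (iter j _ _)).
  by elim: (n) => // k IHk; rewrite mulSn iterD IHk.
pose w := first_letters rho (n * p).
have size_w : size w = (n * p)%N by rewrite size_mkseq.
have wrho : cylinder Phi w rho by rewrite /cylinder /= size_w.
have /andP[+ _] := gibbs w rho (word_first_letters _ _) wrho.
have m1 : fine (m (cylinder Phi w)) <= 1.
  have -> : w = [seq letter rho (val j) | j <- enum 'I_(n * p)].
    by rewrite map_comp val_enum_ord.
  rewrite -(@cylinderE _ (fun j : 'I_(n * p) => letter rho j)).
  have mc := @measurable_word _ (borelEAinf Phi) (fun k r => letter r k)
    measurable_letter (n * p) (fun j => letter rho j).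
  by rewrite -lee_fin probability_fine //; exact: probability_le1.
rewrite size_w sumE natrM mulrCA -mulrBr ler_pdivlMr ?expR_gt0 // ler_pdivrMl //.
move=> /le_trans/(_ (ler_wpM2l (ltW C0) m1)).
by rewrite mulr1 -{1}(lnK C0) ler_expR.
Qed.

Lemma admissible_closed : closed (admissible Phi).
Proof.
have coord_open (k a : nat) :
    open [set w : prod_topology (fun _ : nat => nat) | w k = a].
  rewrite (_ : [set w | _] = @proj nat (fun=> nat) k @^-1` [set a]) //.
  apply: open_comp; last exact: discrete_open.
  by move=> w _; exact: proj_continuous.
pose bad := [set z : nat * (nat * nat) | ~~ adm Phi z.2.1 z.2.2].
rewrite -openC (_ : ~` _ = \bigcup_(z in bad)
    ([set w | w z.1 = z.2.1] `&` [set w | w z.1.+1 = z.2.2])).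
  by apply: bigcup_open => z _; exact: openI.
apply/seteqP; split=> [w /existsNP[k /negP wk]|w [[k [a b]] /= + [wk wk1]]].
  by exists (k, (w k, w k.+1)).
by move=> /negP nab /(_ k); rewrite wk wk1.
Qed.

(** In the full sequence space the box is a product of finite sets, and the
    admissible sequences form a closed subset. *)
Lemma compact_letter_box (n : nat -> nat) :
  compact [set rho : EAinf Phi | forall k, (letter rho k < n k)%N].
Proof.
pose box := [set w : prod_topology (fun _ : nat => nat) |
  forall k, [set i | (i < n k)%N] (w k)].
have box_compact : compact (box `&` admissible Phi).
  apply: compact_closedI admissible_closed.
  apply: (@tychonoff _ (fun=> nat) (fun k => [set i | (i < n k)%N])) => k.
  by apply: finite_compact; exact: finite_II.
move=> G GF GK.
have [|w [[wbox wadm] w_cl]] := box_compact (@set_val _ (admissible Phi) @ G) _.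
  apply: (@filterS _ G _ _ _ _ GK) => rho rhoK; split; first exact: rhoK.
  by move=> k; exact: adm_letter.
pose rho : EAinf Phi := exist (fun w => w \in admissible Phi) w (mem_set wadm).
exists rho; split; first exact: wbox.
move=> A B GA [U [[Z oZ <-] Zrho UB]].
have [|_ [[rho' Arho' <-] Zrho']] :=
  w_cl (set_val @` A) Z _ (open_nbhs_nbhs (conj oZ Zrho)).
- by apply: (@filterS _ G _ _ _ _ GA) => r Ar; exists r.
- by exists rho'; split=> //; apply: UB.
Qed.

(** The [k]-th letter is bounded outside an event of mass
    [eps / 2 ^ (k + 2)]; these masses add up to [eps / 2]. *)
Lemma tight_of_letter_tails (I : Type) (D : set I)
    (mu : I -> probability (borelEAinf Phi) R) :
  (forall i, D i -> shift_invariant (mu i)) ->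
  (forall eps : R, 0 < eps -> exists n, forall i, D i ->
    fine (mu i [set rho | (n <= letter rho 0)%N]) <= eps) ->
  forall eps : R, 0 < eps -> exists K : set (EAinf Phi),
    compact K /\ forall i, D i -> ((1 - eps)%:E < mu i K)%E.
Proof.
move=> inv tails eps eps0.
have eps2 : 0 < eps / 2 by rewrite divr_gt0.
have /choice[n tail_n] k : exists n, forall i, D i ->
    fine (mu i [set rho | (n <= letter rho 0)%N]) <= eps / 2 / (2 ^ k.+1)%:R.
  by apply: tails; rewrite divr_gt0 // ltr0n expn_gt0.
pose K := [set rho : EAinf Phi | forall k, (letter rho k < n k)%N].
exists K; split=> [|i Di]; first exact: compact_letter_box.
pose E k := [set rho : borelEAinf Phi | (n k <= letter rho k)%N].
have mE k : measurable (E k) := measurable_letter k (fun a => (n k <= a)%N).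
have KE : K = ~` \bigcup_k E k.
  apply/seteqP; split=> rho /=.
    by move=> rhoK [k _]; rewrite /E /= leqNgt rhoK.
  by move=> rhoE k; rewrite ltnNge; apply/negP => nk; apply: rhoE; exists k.
have mUE : measurable (\bigcup_k E k) by exact: bigcup_measurable.
rewrite KE probability_setC // -probability_fine // -EFinB lte_fin ltrD2l ltrN2.
have tail_E k : (mu i (E k) <= (eps / 2 / (2 ^ k.+1)%:R)%:E)%E.
  rewrite -probability_fine // lee_fin.
  rewrite /E (shift_invariant_letter _ k (fun a => (n k <= a)%N)); last exact: inv.
  exact: tail_n.
apply: (@le_lt_trans _ _ (eps / 2)).
  rewrite -lee_fin probability_fine //.
  apply: le_trans (generalized_Boole_inequality _ _ _) _ => //.
  rewrite -[leRHS]add0e.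
  have sum_eps := @epsilon_trick _ (fun=> 0%E) _ xpredT (fun=> lexx _) (ltW eps2).
  rewrite [X in (_ <= X + _)%E]eseries0 // in sum_eps.
  apply: le_trans sum_eps; apply: lee_nneseries => // k _.
  rewrite add0e; exact: tail_E.
by rewrite ltr_pdivrMr // ltr_pMr // ltr1n.
Qed.

End symbolic.

(** * Summable weights *)

Section weights.
Context {R : realType} {d : nat} {V : finType} {Phi : cgdms R d V}.
Implicit Types (F : fun_family R d).

(** The case of words of length one in the Hoelder condition. *)
Lemma holder_oscillation F : holder_family Phi F ->
  exists M : R, forall e x y,
    X Phi (tgt Phi e) x -> X Phi (tgt Phi e) y -> `|F e x - F e y| <= M.
Proof.
move=> [b [b0 sup_lty]]; set Z := ereal_sup _ in sup_lty.
exists (fine Z) => e x y xX yX.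
have /ereal_sup_ubound : [set z | exists e w x y,
    [/\ word Phi (e :: w), X Phi (tgtw Phi (e :: w)) x,
        X Phi (tgtw Phi (e :: w)) y &
        z = (`| F e (phiw Phi w x) - F e (phiw Phi w y) |
             * expR (b * (size (e :: w))%:R))%:E]]
    (`|F e x - F e y| * expR (b * 1%:R))%:E by exists e, [::], x, y.
rewrite -/Z; case: Z sup_lty => [z _| //|_]; last by rewrite leNgt ltNyr.
rewrite lee_fin; apply: le_trans; rewrite -[leLHS]mulr1 ler_wpM2l //.
by apply: le_trans (expR_ge1Dx _); rewrite lerDl mulr1 ltW.
Qed.

(** Since [f_e] oscillates by at most [M] above [b e], replacing its supremum
    by [b e] multiplies the terms of the series by at most [exp (- q * M)]. *)
Lemma manhattan_zero_summable F (b : nat -> R) (M q : R) :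
  (forall e x, X Phi (tgt Phi e) x -> b e <= F e x <= b e + M) ->
  q < 0 -> manhattan Phi F (0, q) ->
  (\sum_(0 <= e <oo) (expR (q * b e))%:E < +oo)%E.
Proof.
move=> bF q0; rewrite /manhattan /= => sum_lty.
apply: (@le_lt_trans _ _ (\sum_(0 <= e <oo) ((expR (- (q * M)))%:E *
   poweR (supnorm (X Phi (tgt Phi e)) (fun x => expR (F e x))) q))%E); last first.
  rewrite nneseriesZl; last by move=> e _; exact: poweR_ge0.
  apply: lte_mul_pinfty => //.
  apply: le_lt_trans sum_lty; apply: lee_nneseries.
    by move=> e _ _; exact: poweR_ge0.
  by move=> e _; rewrite poweRe0 mule1.
apply: lee_nneseries => e _; first by move=> _; rewrite lee_fin expR_ge0.
set s := supnorm _ _.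
have s_le : (s <= (expR (b e + M))%:E)%E.
  apply: ge_ereal_sup => _ [x xX <-].
  by rewrite lee_fin ger0_norm ?expR_ge0 // ler_expR; case/andP: (bF _ _ xX).
have [x0 x0X] := X_neq0 Phi (tgt Phi e).
have s_ge : ((expR (F e x0))%:E <= s)%E.
  apply: ereal_sup_ubound; exists x0 => //.
  by rewrite ger0_norm ?expR_ge0.
case: s s_le s_ge => [s||//]; rewrite ?leye_eq // !lee_fin => s_le s_ge.
have s0 : 0 < s by exact: lt_le_trans (expR_gt0 _) s_ge.
have ln_le : ln s <= b e + M by rewrite -ler_expR lnK.
rewrite -(lnK s0) -expRM -expRD ler_expR addrC lerBrDr -mulrDr mulrC.
by apply: ler_wnM2r => //; exact: ltW.
Qed.

(** Everything rests on [q * z <= q1 * z] for [z >= 0] and [q <= q1], applied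
    after subtracting from [b e] one of its lower bounds: [K] for the whole sum,
    which gives [exp (c3 * |q|)], and the larger [c + Lam] for the letters
    [e >= n], which compensates the factor [exp a] with [a = Lam * |q|]. The
    sum is thus at most [exp (c3 * |q|) + 1 <= exp ((c3 + 1) * |q|)], and
    [Lam] is chosen so that the logarithm of this bound is [delta * a]. *)
Lemma uniform_weights (b : nat -> R) (K q1 c delta : R) :
  (forall e, K <= b e) -> q1 < -1 ->
  (\sum_(0 <= e <oo) (expR (q1 * b e))%:E < +oo)%E -> 0 < delta ->
  exists n, forall q, q < q1 -> exists a B, [/\ 0 < a, 1 <= B, ln B <= delta * a &
    forall L, \sum_(e < L) expR (q * (b e - c)) * expR (a * (n <= e)%:R) <= B].
Proof.
move=> Kb q1N sum_lty delta0.
have e0 e : (0 <= (expR (q1 * b e))%:E)%E by rewrite lee_fin expR_ge0.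
pose s := fine (\sum_(0 <= e <oo) (expR (q1 * b e))%:E)%E.
have tail_le n L : ((\sum_(e < L | (n <= e)%N) expR (q1 * b e))%:E
    <= \sum_(n <= e <oo) (expR (q1 * b e))%:E)%E.
  rewrite -(big_geq_mkord _ _ xpredT (fun e => expR (q1 * b e))) -sumEFin.
  exact: nneseries_lim_ge.
have sum_le L : \sum_(e < L) expR (q1 * b e) <= s.
  rewrite -lee_fin /s fineK; first exact: (tail_le 0%N).
  by rewrite ge0_fin_numE // nneseries_ge0.
have s0 : 0 <= s by have := sum_le 0%N; rewrite big_ord0.
(* [exp l] bounds the sum of the [exp (q1 * (b e - K))]; the summand 1 makes [l]
   nonnegative, so that [l <= l * |q|]. *)
pose l := ln (1 + expR (- (q1 * K)) * s).
have l0 : 0 <= l by rewrite ln_ge0 // lerDl mulr_ge0 ?expR_ge0.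
pose c3 := l + `|K - c|.
have c30 : 0 <= c3 by rewrite addr_ge0.
pose Lam := (c3 + 1) / delta.
have [n tail_n] : exists n, forall L,
    \sum_(e < L | (n <= e)%N) expR (q1 * b e) <= expR (q1 * (c + Lam)).
  have := nneseries_tail_cvg sum_lty (fun e _ => e0 e).
  move=> /fine_cvgP[[N1 _ fin_tail]].
  move=> /cvgrPdist_le /(_ _ (expR_gt0 (q1 * (c + Lam))))[N2 _ N2P].
  exists (maxn N1 N2) => L.
  have := N2P _ (leq_maxr N1 N2); rewrite sub0r normrN => /(le_trans (ler_norm _)).
  apply: le_trans; rewrite -lee_fin fineK; first exact: tail_le.
  exact: fin_tail (leq_maxl _ _).
exists n => q qq1.
pose Q := - q.
have Q1 : 1 < Q by rewrite /Q ltrNr (lt_trans qq1).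
have Q0 : 0 < Q by exact: lt_trans Q1.
have qN : q < 0 by rewrite -oppr_gt0.
exists (Lam * Q), (expR ((c3 + 1) * Q)).
have Lam0 : 0 < Lam by rewrite divr_gt0 // ltr_wpDl.
split.
- by rewrite mulr_gt0.
- by rewrite -expR0 ler_expR mulr_ge0 ?(ltW Q0) // addr_ge0.
- by rewrite expRK mulrA (mulrC delta) /Lam divfK // gt_eqF.
move=> L.
have le_all : \sum_(e < L) expR (q * (b e - c)) <= expR (c3 * Q).
  apply: (@le_trans _ _ (\sum_(e < L) expR (q * (K - c)) *
      (expR (- (q1 * K)) * expR (q1 * b e)))).
    apply: ler_sum => e _; rewrite -!expRD ler_expR.
    rewrite (_ : b e - c = (b e - K) + (K - c)); last by rewrite addrA subrK.
    rewrite mulrDr addrC lerD2l -mulrN -mulrDr [- K + _]addrC.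
    by apply: ler_wpM2r; [rewrite subr_ge0|exact: ltW].
  rewrite -!mulr_sumr mulrDl expRD [leRHS]mulrC.
  apply: ler_pM; first exact: expR_ge0.
  - by rewrite mulr_ge0 ?expR_ge0 // sumr_ge0 // => e _; exact: expR_ge0.
  - by rewrite ler_expR (le_trans (ler_norm _)) // normrM mulrC (ltr0_norm qN).
  apply: (@le_trans _ _ (expR l)); last first.
    by rewrite ler_expR ler_peMr // ltW.
  rewrite lnK ?posrE ?ltr_wpDr ?mulr_ge0 ?expR_ge0 //.
  by rewrite ler_wpDl // ler_wpM2l ?expR_ge0.
have le_tail : \sum_(e < L | (n <= e)%N) expR (q * (b e - c)) * expR (Lam * Q) <= 1.
  (* A single term of the small tail is already small, which bounds [b e] from
     below. *)
  have b_large e : (n <= e)%N -> c + Lam <= b e.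
    move=> ne; have : expR (q1 * b e) <= expR (q1 * (c + Lam)).
      apply: le_trans (tail_n e.+1); rewrite big_mkcond big_ord_recr /= ne.
      rewrite lerDr; apply: sumr_ge0 => i _.
      by case: ifP => // _; exact: expR_ge0.
    by rewrite ler_expR ler_nM2l // (lt_trans q1N).
  apply: (@le_trans _ _ (expR (- (q1 * (c + Lam))) *
      \sum_(e < L | (n <= e)%N) expR (q1 * b e))).
    rewrite mulr_sumr; apply: ler_sum => e ne; rewrite -!expRD ler_expR.
    rewrite /Q mulrN [Lam * q]mulrC -mulrBr [leRHS]addrC -mulrBr -addrA -opprD.
    by apply: ler_wpM2r; [rewrite subr_ge0 b_large|exact: ltW].
  by rewrite expRN ler_pdivrMl ?expR_gt0 // mulr1.
have split_sum : \sum_(e < L) expR (q * (b e - c)) * expR (Lam * Q * (n <= e)%:R) <=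
    \sum_(e < L) expR (q * (b e - c)) +
    \sum_(e < L | (n <= e)%N) expR (q * (b e - c)) * expR (Lam * Q).
  rewrite [X in _ + X]big_mkcond -big_split /=; apply: ler_sum => e _.
  case: (n <= e)%N; last by rewrite mulr0 expR0 mulr1 addr0.
  by rewrite mulr1 lerDr expR_ge0.
apply: le_trans split_sum _; apply: le_trans (lerD le_all le_tail) _.
rewrite (mulrDl c3 1) mul1r expRD.
apply: (@le_trans _ _ (expR (c3 * Q) * (1 + 1))).
  by rewrite mulrDr mulr1 lerD2l -expR0 ler_expR mulr_ge0 // ltW.
rewrite ler_wpM2l ?expR_ge0 //; apply: le_trans (expR_ge1Dx _).
by rewrite lerD2l ltW.
Qed.

End weights.

(** * Uniform tails *)

Section uniform_tails.
Context {R : realType} {d : nat} {V : finType} {Phi : cgdms R d V}.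
Implicit Types (F : fun_family R d) (rho : EAinf Phi).

(** A word that leads from the letter 0 back to itself can be repeated. *)
Lemma exists_periodic : finitely_irreducible Phi ->
  exists (rho : EAinf Phi) (p : nat),
    (0 < p)%N /\ iter p (sigma Phi) rho = rho.
Proof.
move=> [_ [_ /(_ 0%N 0%N)[tau _ word_loop]]].
pose u := 0%N :: tau; pose p := size u.
pose per k := nth 0%N u (k %% p).
have per_adm : admissible Phi per.
  move=> k; have lt_kp : (k %% p < p)%N by rewrite ltn_mod.
  have := sortedP 0%N word_loop; rewrite -cat_cons -/u size_cat addn1.
  move=> /(_ (k %% p)%N lt_kp); rewrite !nth_cat lt_kp /per.
  rewrite -[k.+1]addn1 -modnDml addn1 -/p.
  have [lt_k1p|ge_k1p] := ltnP (k %% p).+1 p; first by rewrite (modn_small lt_k1p).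
  have -> : (k %% p).+1 = p by apply/eqP; rewrite eqn_leq lt_kp.
  by rewrite subnn modnn.
exists (exist (fun w => w \in admissible Phi) per (mem_set per_adm)), p.
split=> //; apply: letter_ext => k; rewrite letter_iter_sigma.
by rewrite -[LHS]/(per (p + k)) -[RHS]/(per k) /per modnDl.
Qed.

(** The geometric part of the potential is nonpositive because the maps
    contract; in the other part the negative [q] reverses the bound on [f_e]. *)
Lemma potential_le F t q (b : nat -> R) :
  (forall e x, X Phi (tgt Phi e) x -> b e <= F e x) -> 0 <= t -> q <= 0 ->
  forall rho : EAinf Phi, potential Phi F t q rho <= q * b (letter rho 0).
Proof.
move=> bF t0 q0 rho.
have codX : X Phi (tgt Phi (letter rho 0)) (coding (sigma Phi rho)).
  by rewrite (adm_match (adm_letter rho 0)); exact: (coding_in_X (sigma Phi rho)).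
rewrite /potential /amalgamated -[leRHS]add0r lerD //.
  rewrite mulr_ge0_le0 //; apply: ln_le0; apply: scaling_le1.
  exact: X_sub_W codX.
by apply: ler_wnM2l => //; exact: bF.
Qed.

(** The Birkhoff sum of the potential over one period is [a + q * A F] with [a]
    and [A F] independent of [q]; for [q <= -1] it is at least
    [q * (|a| + |A F|)]. *)
Lemma periodic_pressure_bound F rho p t :
  (0 < p)%N -> iter p (sigma Phi) rho = rho ->
  exists c : R, forall q P C (m : probability (borelEAinf Phi) R),
    q <= -1 -> 0 < C -> gibbs_bounds m (potential Phi F t q) P C -> q * c <= P.
Proof.
move=> p0 per; have p0R : 0 < p%:R :> R by rewrite ltr0n.
pose A (G : fun_family R d) := \sum_(j < p) amalgamated G (iter j (sigma Phi) rho).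
pose a := t * A (log_deriv Phi).
exists ((`|a| + `|A F|) / p%:R) => q P C m q1 C0 gb.
have := gibbs_periodic_le _ _ _ _ _ _ gb C0 per.
rewrite big_split /= -!mulr_sumr -/(A _) -/(A _) -/a => le_P.
rewrite mulrA ler_pdivrMr //; apply: le_trans le_P.
have q0 : q <= 0 by apply: le_trans q1 _; rewrite oppr_le0.
rewrite mulrDr lerD //; last by apply: ler_wnM2l => //; exact: ler_norm.
apply: (@le_trans _ _ (- `|a|)); last by rewrite lerNl -normrN ler_norm.
by rewrite -mulN1r; apply: ler_wpM2r.
Qed.

(** The threshold [n] comes from [uniform_weights], hence before [q]; the Gibbs
    constant of [mu q] enters only through [mean_letter_weight]. *)
Lemma letter_tails_uniform F q1 t (mu : R -> probability (borelEAinf Phi) R) :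
  finitely_irreducible Phi -> holder_family Phi F -> bounded_below Phi F ->
  q1 < -1 -> manhattan Phi F (0, q1) -> 0 <= t ->
  (forall q, q < q1 ->
     shift_invariant (mu q) /\ gibbs (mu q) (potential Phi F t q)) ->
  forall eps : R, 0 < eps -> exists n, forall q, q < q1 ->
    fine (mu q [set rho | (n <= letter rho 0)%N]) <= eps.
Proof.
move=> irr /holder_oscillation[M osc] [K KF] q1N manh t0 mu_gibbs eps eps0.
pose x0 e := xget 0 (X Phi (tgt Phi e)).
have x0X e : X Phi (tgt Phi e) (x0 e) by apply: xgetPex; exact: X_neq0.
pose b e := F e (x0 e) - M.
have bF e x : X Phi (tgt Phi e) x -> b e <= F e x <= b e + 2 * M.
  move=> xX; have := osc e x (x0 e) xX (x0X e); rewrite ler_norml /b; lra.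
have Kb e : K - M <= b e by rewrite lerD2r; exact: KF.
have [rho [p [p0 per]]] := exists_periodic irr.
have [c c_le] := periodic_pressure_bound F rho p t p0 per.
have q1_lt0 : q1 < 0 by apply: lt_trans q1N _; rewrite oppr_lt0.
have sum_lty := manhattan_zero_summable _ _ _ _ bF q1_lt0 manh.
have [n weights] := uniform_weights _ _ _ c _ Kb q1N sum_lty eps0.
exists n => q qq1; have [inv [P [C [C1 gb]]]] := mu_gibbs q qq1.
have [a [B [a0 B1 lnB sumB]]] := weights q qq1.
have C0 : 0 < C by exact: lt_le_trans ltr01 C1.
have q_lt0 : q < 0 by exact: lt_trans qq1 q1_lt0.
have q_le : q <= -1 by apply: ltW; exact: lt_trans qq1 q1N.
have c_leP : q * c <= P by exact: (c_le q P C (mu q) q_le C0 gb).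
have pot_le : forall rho : EAinf Phi,
    potential Phi F t q rho <= q * b (letter rho 0).
  by apply: potential_le => //; [move=> e x /bF/andP[]|exact: ltW].
have := @mean_letter_weight _ (borelEAinf Phi) R (mu q) (fun k r => letter r k)
  (fun e => expR (q * b e - P)) (fun e => (n <= e)%N) a C B
  measurable_letter (fun k Q => shift_invariant_letter _ k Q inv)
  (gibbs_cylinder_le _ _ (fun e => q * b e) _ _ gb (ltW C0) pot_le)
  (fun e => expR_ge0 _) (ltW a0) C1 B1.
move=> weight_le; rewrite -(ler_pM2l a0).
apply: le_trans (weight_le _) _; last by rewrite mulrC.
move=> L; apply: le_trans (sumB L); apply: ler_sum => e _.
by rewrite ler_wpM2r ?expR_ge0 // ler_expR [leRHS]mulrBr; apply: lerB.
Qed.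

End uniform_tails.

Theorem proposition1p1p2 (R : realType) (d : nat) (V : finType)
    (Phi : cgdms R d V) (F : fun_family R d) (q1 t : R)
    (mu : R -> probability (borelEAinf Phi) R) :
  (0 < d)%N ->
  finitely_irreducible Phi ->
  holder_family Phi F ->
  bounded_below Phi F ->
  q1 < -1 ->
  manhattan Phi F (0, q1) ->
  0 <= t -> (t%:E <= bowen Phi)%E ->
  (forall q, q < q1 ->
     shift_invariant (mu q) /\ gibbs (mu q) (potential Phi F t q)) ->
  forall eps : R, 0 < eps ->
    exists K : set (EAinf Phi), compact K /\
      forall q, q < q1 -> ((1 - eps)%:E < mu q K)%E.
Proof.
move=> _ irr holder bbelow q1N manh t0 _ mu_gibbs.
apply: (@tight_of_letter_tails _ _ _ _ _ [set q | q < q1]) => [q qq1|eps eps0].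
  by have [] := mu_gibbs q qq1.
exact: (letter_tails_uniform F q1 t).
Qed.
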